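(* Let $A_k=\{0=a_0<a_1<\cdots<a_k\}$ be a restricted basis with range $n$. Let $i$ be an index with $0<i<k-1$, and let $j=k-1-i$. Then: (1) The prefix $A_i=\{a_0,\ldots,a_i\}$ is an admissible basis with $n_2(A_i)\ge a_k-n_2(j-1)-2$. (2) The mirrored suffix $B_j=a_k-\{a_{i+1},\ldots,a_k\}=\{a_k-a_{i+1},\ldots,a_k-a_k\}$ is an admissible basis with $n_2(B_j)\ge a_k-n_2(i-1)-2$. Here $n_2(m)$ denotes the maximum range among all bases of length $m$.
   Context: For a set of integers $A$, $2A=A+A=\{a+a': a,a'\in A\}$, and $[c,d]=\{c,\ldots,d\}$. A basis of length $m$ is a set of integers $A_m=\{0=a_0<a_1<\cdots<a_m\}$ (the element $0$ is not counted in the length). Its range $n_2(A_m)$ is the largest $n$ with $2A_m\supseteq[0,n]$. A basis is admissible if $n_2(A_m)\ge a_m$, and restricted if $n_2(A_m)\ge 2a_m$. For an integer $b$ and set $A$, $b-A=\{b-a:a\in A\}$. For $m\ge 0$, $n_2(m)$ is the maximum of $n_2(A_m)$ over all bases $A_m$ of length $m$ (so $n_2(0)=0$, the basis being $\{0\}$). *)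

(* Defs.v *)
From mathcomp Require Import all_boot all_order all_algebra.
From mathcomp Require Import boolp classical_sets set_interval.

Set Implicit Arguments.
Unset Strict Implicit.
Unset Printing Implicit Defensive.

Import Order.TTheory GRing.Theory Num.Theory.

Local Open Scope classical_set_scope.
Local Open Scope ring_scope.

(* Junk value 0 if [P] has no largest element; [largestP] below covers the
   other case, and [n2P], [n2_maxP] show that it is the only one used. *)
Definition largest (P : set nat) : nat :=
  xget 0%N [set n | P n /\ forall p, P p -> (p <= n)%N].

Definition sumset2 (A : set int) : set int := [set x + y | x in A & y in A].

Definition reflect_set (b : int) (A : set int) : set int :=
  [set b - x | x in A].

Definition covers (A : set int) (n : nat) : Prop :=
  `[0, n%:Z]%classic `<=` sumset2 A.

Definition n2 (A : set int) : nat := largest (covers A).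

(* [A = {0 = a 0 < a 1 < ... < a m}]; values of [a] beyond [m] are irrelevant. *)
Definition enumerates (m : nat) (a : nat -> int) (A : set int) : Prop :=
  [/\ a 0%N = 0,
      forall l, (l < m)%N -> a l < a l.+1
    & A = [set a l | l in [set l | (l <= m)%N]]].

Definition basis (m : nat) (A : set int) : Prop :=
  exists a, enumerates m a A.

Definition admissible (m : nat) (A : set int) : Prop :=
  exists2 a, enumerates m a A & a m <= (n2 A)%:Z.

Definition restricted (m : nat) (A : set int) : Prop :=
  exists2 a, enumerates m a A & 2 * a m <= (n2 A)%:Z.

Definition n2_max (m : nat) : nat :=
  largest [set r | exists2 A, basis m A & n2 A = r].

Lemma largestP (P : set nat) (b : nat) :
  P !=set0 -> (forall n, P n -> (n <= b)%N) ->
  P (largest P) /\ forall n, P n -> (n <= largest P)%N.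
Proof.
move=> [n0 Pn0] Pb.
have exP : exists n, `[< P n >] by exists n0; apply/asboolP.
have ubP n : `[< P n >] -> (n <= b)%N by move=> /asboolP /Pb.
case: (ex_maxnP exP ubP) => n /asboolP Pn maxn.
rewrite /largest; case: xgetP => [x _ //|/(_ n) []].
by split=> // p Pp; apply: maxn; apply/asboolP.
Qed.

Lemma covers_bound (m n : nat) (A : set int) :
  basis m A -> covers A n -> (n <= m.+1 * m.+1)%N.
Proof.
move=> [a [_ _ ->]] cov.
pose s := [seq a p + a q | p <- iota 0 m.+1, q <- iota 0 m.+1].
have <- : size s = (m.+1 * m.+1)%N by rewrite size_allpairs size_iota.
apply: (@leq_trans n.+1) => //.
rewrite -(size_iota 0 n.+1) -(size_map Posz).
apply: uniq_leq_size; first by rewrite map_inj_uniq ?iota_uniq // => x y [].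
move=> _ /mapP[x + ->]; rewrite mem_iota add0n ltnS => /= xn.
have /cov : `[0, n%:Z]%classic x%:Z by rewrite /= in_itv /= lez_nat xn.
move=> [_ [p /= pm <-]] [_ [q /= qm <-]] <-.
by apply: (allpairs_f (fun p q => a p + a q)); rewrite mem_iota.
Qed.

Lemma n2P (m : nat) (A : set int) : basis m A ->
  covers A (n2 A) /\ forall n, covers A n -> (n <= n2 A)%N.
Proof.
move=> bA; apply: (@largestP _ (m.+1 * m.+1)); last first.
  by move=> n; apply: covers_bound bA.
case: bA => a [a0 _ ->]; exists 0%N => x /=; rewrite in_itv /= => x0.
have -> : x = 0 by apply/eqP; rewrite eq_le andbC.
exists 0; first by exists 0%N.
by exists 0; [exists 0%N | rewrite addr0].
Qed.

Lemma n2_maxP (m : nat) :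
  (exists2 A, basis m A & n2 A = n2_max m) /\
  forall A, basis m A -> (n2 A <= n2_max m)%N.
Proof.
have [||wit ub] := @largestP [set r | exists2 A, basis m A & n2 A = r]
  (m.+1 * m.+1).
- exists (n2 [set Posz l | l in [set l | (l <= m)%N]]).
  exists [set Posz l | l in [set l | (l <= m)%N]] => //.
  by exists Posz; split=> // l _; rewrite ltz_nat.
- by move=> _ [A bA <-]; apply: covers_bound (bA) (n2P bA).1.
by split=> // A bA; apply: ub; exists A.
Qed.

Lemma n2_max0 : n2_max 0 = 0%N.
Proof.
case: (n2_maxP 0) => -[A bA <-] _; have [cov _] := n2P bA.
have : `[0, (n2 A)%:Z]%classic (n2 A)%:Z by rewrite /= in_itv /= !lexx.
move: (n2 A) cov => n + /[dup] _ xn => /(_ _ xn).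
case: bA => a [a0 _ ->] [_ [p /= + <-]] [_ [q /= + <-]].
rewrite !leqn0 => /eqP -> /eqP ->; rewrite a0 addr0.
by case.
Qed.

(* Main.v *)
Require Import Defs.
From mathcomp Require Import all_boot all_order all_algebra.
From mathcomp Require Import classical_sets set_interval.
From mathcomp Require Import zify.
Import Order.TTheory Order.NatMonotonyTheory GRing.Theory Num.Theory.
Local Open Scope classical_set_scope.
Local Open Scope ring_scope.

Set Implicit Arguments.
Unset Strict Implicit.
Unset Printing Implicit Defensive.

(** In a basis [A], a sum smaller than [a (i + 1)] only uses the prefix [A_i],
    so if [A] is admissible then [a (i + 1) <= n2 A_i + 1].  The reflection of
    a restricted basis, enumerated by [b l = a k - a (k - l)], is again
    restricted, hence admissible.  In [a k = a (i + 1) + b (k - i - 1)],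
    bounding the first summand through [A_i] and the second through a prefix
    of length [k - i - 2] of the reflection gives (1).  As the mirrored
    suffixes of [A] are the prefixes of its reflection, (2) is (1) applied to
    the reflection. *)

Definition prefix_set (a : nat -> int) (i : nat) : set int :=
  [set a l | l in [set l : nat | (l <= i)%N]].

Definition reflect_enum (k : nat) (a : nat -> int) (l : nat) : int :=
  a k - a (k - l)%N.

Lemma le_n2P (m : nat) (A : set int) (z : int) : basis m A ->
  z <= (n2 A)%:Z <-> `[0, z]%classic `<=` sumset2 A.
Proof.
move=> /n2P[cov_n2 max_n2]; split=> [z_le|]; last by case: z => // p /max_n2.
by apply: subset_trans cov_n2; apply: subset_itvl; rewrite bnd_simp.
Qed.

Lemma sumset2_reflect (b : int) (A : set int) :
  sumset2 (reflect_set b A) = reflect_set (2 * b) (sumset2 A).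
Proof.
apply/seteqP; split=> x.
  move=> [_ [p Ap <-]] [_ [q Aq <-]] <-.
  by exists (p + q); [exists p => //; exists q | lia].
move=> [_ [p Ap] [q Aq <-] <-].
by exists (b - p); [exists p | exists (b - q); [exists q | lia]].
Qed.

Lemma reflect_segment (k i : nat) (a : nat -> int) : (i <= k)%N ->
  reflect_set (a k) [set a l | l in [set l : nat | (i <= l <= k)%N]] =
  prefix_set (reflect_enum k a) (k - i).
Proof.
move=> ik; apply/seteqP; split=> x.
  move=> [_ [l /= lk <-] <-]; exists (k - l)%N => /=; first by lia.
  by rewrite /reflect_enum subKn //; lia.
move=> [l /= lk <-]; exists (a (k - l)%N) => //.
by exists (k - l)%N => //=; lia.
Qed.

Section Enumeration.
Variables (k : nat) (a : nat -> int) (A : set int).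
Hypothesis eA : enumerates k a A.

Lemma enumerates_basis : basis k A.
Proof. by exists a. Qed.

Lemma enumerates_le_mono :
  {in [pred l | (l <= k)%N] &, {mono a : p q / (p <= q)%N >-> p <= q}}.
Proof.
have [_ inc _] := eA; apply: incn_inP => [p q _ qk l /andP[_ lq]|l _].
  exact: leq_trans (ltnW lq) qk.
exact: inc.
Qed.

Lemma enumerates_bounds (x : int) : A x -> 0 <= x <= a k.
Proof.
have [<- _ ->] := eA => -[l lk <-].
by rewrite !enumerates_le_mono ?inE.
Qed.

Lemma enumerates_last_in : A (a k).
Proof. by have [_ _ ->] := eA; exists k => /=. Qed.

Lemma enumerates_last_ge0 : 0 <= a k.
Proof. by have /andP[] := enumerates_bounds enumerates_last_in. Qed.

Lemma enumerates_prefix (i : nat) :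
  (i <= k)%N -> enumerates i a (prefix_set a i).
Proof.
move=> ik; have [a0 inc _] := eA.
by split=> // l li; apply: inc; apply: leq_trans ik.
Qed.

Lemma enumerates_reflect :
  enumerates k (reflect_enum k a) (reflect_set (a k) A).
Proof.
have [a0 inc ->] := eA; split; first by rewrite /reflect_enum subn0 subrr.
  by move=> l lk; rewrite ltrD2l ltrN2 -(subnSK lk) inc //; lia.
by rewrite (reflect_segment a (leq0n k)) subn0.
Qed.

Lemma reflect_enum_last : reflect_enum k a k = a k.
Proof. by have [a0 _ _] := eA; rewrite /reflect_enum subnn a0 subr0. Qed.

Lemma sumset2_prefix (i : nat) (x : int) :
  (i < k)%N -> x < a i.+1 -> sumset2 A x -> sumset2 (prefix_set a i) x.
Proof.
move=> ik x_lt [p Ap [q Aq pqx]].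
have prefix_of_lt y : A y -> y < a i.+1 -> prefix_set a i y.
  have [_ _ ->] := eA => -[l lk <-]; rewrite ltNge enumerates_le_mono ?inE //.
  by rewrite -ltnNge ltnS => li; exists l.
have /andP[p_ge0 _] := enumerates_bounds Ap.
have /andP[q_ge0 _] := enumerates_bounds Aq.
by exists p; [|exists q => //]; apply: prefix_of_lt => //; lia.
Qed.

End Enumeration.

Lemma enumerates_last_eq (k m : nat) (a b : nat -> int) (A : set int) :
  enumerates k a A -> enumerates m b A -> a k = b m.
Proof.
move=> eA eB.
have /andP[_ a_le_b] := enumerates_bounds eB (enumerates_last_in eA).
have /andP[_ b_le_a] := enumerates_bounds eA (enumerates_last_in eB).
by apply: le_anti; rewrite a_le_b.
Qed.

Section Admissible.
Variables (k : nat) (a : nat -> int) (A : set int).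
Hypotheses (eA : enumerates k a A) (admA : admissible k A).

Lemma admissible_last_le : a k <= (n2 A)%:Z.
Proof. by have [b eB] := admA; rewrite (enumerates_last_eq eA eB). Qed.

Lemma next_le_n2_prefix (i : nat) :
  (i < k)%N -> a i.+1 <= (n2 (prefix_set a i))%:Z + 1.
Proof.
move=> ik; have bas_i := enumerates_basis (enumerates_prefix eA (ltnW ik)).
rewrite -lerBlDr; apply/(le_n2P _ bas_i) => x /=; rewrite in_itv /= => x_itv.
apply: (sumset2_prefix eA ik); first by lia.
apply: (le_n2P _ (enumerates_basis eA)).1 admissible_last_le _ _.
have : a i.+1 <= a k by rewrite (enumerates_le_mono eA) ?inE.
by rewrite /= in_itv /=; lia.
Qed.

Lemma admissible_prefix (i : nat) :
  (i <= k)%N -> admissible i (prefix_set a i).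
Proof.
rewrite leq_eqVlt => /predU1P[->|ik].
  by rewrite /prefix_set; have [_ _ <-] := eA.
exists a; first exact: (enumerates_prefix eA (ltnW ik)).
by have [_ /(_ i ik) inc _] := eA; have := next_le_n2_prefix ik; lia.
Qed.

Lemma next_le_n2_max (i : nat) : (i < k)%N -> a i.+1 <= (n2_max i)%:Z + 1.
Proof.
move=> ik; apply: le_trans (next_le_n2_prefix ik) _; rewrite lerD2r lez_nat.
exact: (n2_maxP i).2 (enumerates_basis (enumerates_prefix eA (ltnW ik))).
Qed.

End Admissible.

Section Restricted.
Variables (k : nat) (a : nat -> int) (A : set int).
Hypotheses (eA : enumerates k a A) (resA : restricted k A).

Lemma restricted_last_le : 2 * a k <= (n2 A)%:Z.
Proof. by have [b eB] := resA; rewrite (enumerates_last_eq eA eB). Qed.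

Lemma restricted_admissible : admissible k A.
Proof.
exists a => //; have := enumerates_last_ge0 eA.
by have := restricted_last_le; lia.
Qed.

Lemma restricted_reflect : restricted k (reflect_set (a k) A).
Proof.
exists (reflect_enum k a); first exact: enumerates_reflect.
rewrite (reflect_enum_last eA).
apply/(le_n2P _ (enumerates_basis (enumerates_reflect eA))) => x /=.
rewrite in_itv /= => x_itv; rewrite sumset2_reflect.
exists (2 * a k - x); last by rewrite subKr.
apply: (le_n2P _ (enumerates_basis eA)).1 restricted_last_le _ _.
by rewrite /= in_itv /=; lia.
Qed.

End Restricted.

Lemma restricted_last_le_n2_prefix (k i j : nat) (a : nat -> int)
    (A : set int) :
  enumerates k a A -> restricted k A -> (i + j).+2 = k ->
  a k <= (n2 (prefix_set a i))%:Z + (n2_max j)%:Z + 2.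
Proof.
move=> eA resA ijk; have eB := enumerates_reflect eA.
have admB := restricted_admissible eB (restricted_reflect eA resA).
have ik : (i < k)%N by lia.
have jk : (j < k)%N by lia.
have a_le := next_le_n2_prefix eA (restricted_admissible eA resA) ik.
have b_le := next_le_n2_max eB admB jk.
have bE : reflect_enum k a j.+1 = a k - a i.+1 by congr (_ - a _); lia.
lia.
Qed.

Theorem theorem6 (k n i j : nat) (A : set int) (a : nat -> int)
    (hA : enumerates k a A) (hres : restricted k A) (hn : n2 A = n)
    (hi0 : (0 < i)%N) (hik : (i < k - 1)%N) (hj : j = (k - 1 - i)%N) :
  let Ai := [set a l | l in [set l : nat | (l <= i)%N]] in
  let Bj := reflect_set (a k) [set a l | l in [set l : nat | (i < l <= k)%N]] in
  (admissible i Ai /\ (n2 Ai)%:Z >= a k - (n2_max (j - 1))%:Z - 2) /\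
  (admissible j Bj /\ (n2 Bj)%:Z >= a k - (n2_max (i - 1))%:Z - 2).
Proof.
move=> Ai Bj; have hB := enumerates_reflect hA.
have resB := restricted_reflect hA hres.
have -> : Bj = prefix_set (reflect_enum k a) j.
  by rewrite hj -subnDA add1n; apply: reflect_segment; lia.
rewrite -[Ai]/(prefix_set a i).
split; split.
- by apply: (admissible_prefix hA (restricted_admissible hA hres)); lia.
- have ijk : (i + (j - 1)).+2 = k by lia.
  by have := restricted_last_le_n2_prefix hA hres ijk; lia.
- by apply: (admissible_prefix hB (restricted_admissible hB resB)); lia.
- have jik : (j + (i - 1)).+2 = k by lia.
  have := restricted_last_le_n2_prefix hB resB jik.
  by rewrite (reflect_enum_last hA); lia.
Qed.
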